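(* Let $(x^k,y^k,\xi^k)_{k\ge 0}$ be generated by the LLM-VOS algorithm (described in the context). Then the Lagrange multiplier satisfies $\xi^k>0$ for all $k\ge0$. Furthermore, the algorithm is unconditionally energy stable in the sense that, for all $\Delta t>0$ and all $k\ge0$, $$\tilde{\mathcal E}^{k+1}-\tilde{\mathcal E}^{k}=-\Delta t\,\eta^{k+1}\|y^{k+1}-x^{k+1}\|^2\le0,$$ where $\tilde{\mathcal E}^{k+1}=\xi^{k+1}\mathcal E(x^k,y^k)$.
   Context: $\mathbb R^N$ carries the standard inner product and norm $\|\cdot\|$. The function $f:\mathbb R^N\to\mathbb R$ is differentiable and has a minimizer. The pseudo-energy is $\mathcal E(x,y):=f(x)+\frac12\|y-x\|^2$. Standing assumption: $\mathcal E(x,y)>0$ for all $x,y$ (equivalently $f>0$ everywhere). The damping coefficients satisfy $\eta^k>0$ for all $k\ge1$, and it is assumed that $\frac1{\Delta t}+\Delta t+(1-\Delta t)\eta^{k+1}\ne0$ for all $k\ge0$, so that the algorithm is well defined. LLM-VOS algorithm. Inputs: $x^0,y^0\in\mathbb R^N$, $\Delta t>0$, $\xi^0=1$. Set $x^{-1}=x^0$, $y^{-1}=y^0$, $v^0=y^0-x^0$, and write $\mathcal E^k:=\mathcal E(x^k,y^k)$ for $k\ge-1$. For $k=0,1,2,\dots$: (1) $z^{k+1}=\dfrac{1}{\frac1{\Delta t}+\Delta t+(1-\Delta t)\eta^{k+1}}\left(\dfrac{v^k}{\Delta t}-(1-\Delta t)\nabla f(x^k)\right)$; (2) if $\|z^{k+1}\|\ne0$,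 $\xi^{k+1}=\dfrac{-\frac{\mathcal E^k}{\Delta t}+\sqrt{\left(\frac{\mathcal E^k}{\Delta t}\right)^2+4\eta^{k+1}\|z^{k+1}\|^2\frac{\xi^k\mathcal E^{k-1}}{\Delta t}}}{2\eta^{k+1}\|z^{k+1}\|^2}$; otherwise $\xi^{k+1}=\dfrac{\xi^k\mathcal E^{k-1}}{\mathcal E^k}$; (3) $y^{k+1}=y^k+\Delta t\left((1-\eta^{k+1})z^{k+1}\xi^{k+1}-\xi^{k+1}\nabla f(x^k)\right)$; (4) $x^{k+1}=x^k+(1-\xi^{k+1})(y^k-x^k)+\Delta t\left(z^{k+1}\xi^{k+1}+y^{k+1}-y^k\right)$; (5) $v^{k+1}=y^{k+1}-x^{k+1}$. The modified pseudo-energy is $\tilde{\mathcal E}^{k+1}:=\xi^{k+1}\mathcal E^k$ for $k\ge-1$; in particular $\tilde{\mathcal E}^0=\xi^0\mathcal E^{-1}=\mathcal E(x^0,y^0)$. *)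

(* Defs.v *)
From HB Require Import structures.
From mathcomp Require Export all_boot all_order all_algebra.
From mathcomp Require Export all_classical all_reals all_analysis.
Export Order.TTheory GRing.Theory Num.Theory.
Export numFieldNormedType.Exports.

Set Implicit Arguments.
Unset Strict Implicit.
Unset Printing Implicit Defensive.

Local Open Scope ring_scope.

Definition dot (R : realType) (N : nat) (u v : 'rV[R]_N) : R :=
  \sum_(i < N) u 0 i * v 0 i.

(* The library norm `|u| on 'rV[R]_N is the sup norm, not the Euclidean one.
   Both induce the same topology, so the library's differentiability on
   'rV[R]_N is the usual one. *)
Definition enorm (R : realType) (N : nat) (u : 'rV[R]_N) : R :=
  Num.sqrt (dot u u).

Definition grad (R : realType) (N : nat) (f : 'rV[R]_N -> R) (x : 'rV[R]_N) :
  'rV[R]_N := \row_(i < N) 'D_(delta_mx 0 i) f x.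

Lemma diff_grad (R : realType) (N : nat) (f : 'rV[R]_N -> R) (x h : 'rV[R]_N) :
  differentiable f x -> 'd f x h = dot (grad f x) h.
Proof.
move=> df; rewrite {1}(row_sum_delta h) linear_sum; apply: eq_bigr => i _.
by rewrite linearZ /= mxE deriveE // mulrC.
Qed.

Definition pseudo_energy (R : realType) (N : nat) (f : 'rV[R]_N -> R)
    (x y : 'rV[R]_N) : R :=
  f x + 2^-1 * enorm (y - x) ^+ 2.

(* E^(k-1) for k >= 0. Since 0.-1 = 0, the value at k = 0 is E(x^0, y^0),
   which is E^(-1) because x^(-1) = x^0 and y^(-1) = y^0. *)
Definition prev_energy (R : realType) (N : nat) (f : 'rV[R]_N -> R)
    (x y : nat -> 'rV[R]_N) (k : nat) : R :=
  pseudo_energy f (x k.-1) (y k.-1).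

(* xi^k E^(k-1), i.e. the paper's \tilde E^k, for k >= 0. *)
Definition modified_energy (R : realType) (N : nat) (f : 'rV[R]_N -> R)
    (x y : nat -> 'rV[R]_N) (xi : nat -> R) (k : nat) : R :=
  xi k * prev_energy f x y k.

Definition vos_denom (R : realType) (dt eta : R) : R :=
  1 / dt + dt + (1 - dt) * eta.

(* The sequences produced from the inputs x^0 = x 0, y^0 = y 0. The values z 0
   and eta 0 are never used. *)
Record LLM_VOS (R : realType) (N : nat) (f : 'rV[R]_N -> R) (dt : R)
    (eta : nat -> R) (x y z v : nat -> 'rV[R]_N) (xi : nat -> R) : Prop := {
  vos_xi0 : xi 0%N = 1;
  vos_v0 : v 0%N = y 0%N - x 0%N;
  vos_z : forall k : nat,
    z k.+1 = (1 / vos_denom dt (eta k.+1))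
               *: (dt^-1 *: v k - (1 - dt) *: grad f (x k));
  vos_xi : forall k : nat,
    let Ek := pseudo_energy f (x k) (y k) in
    let Ep := prev_energy f x y k in
    let c := eta k.+1 * enorm (z k.+1) ^+ 2 in
    xi k.+1 =
      if enorm (z k.+1) != 0 then
        (- (Ek / dt) + Num.sqrt ((Ek / dt) ^+ 2 + 4 * c * (xi k * Ep / dt)))
          / (2 * c)
      else xi k * Ep / Ek;
  vos_y : forall k : nat,
    y k.+1 = y k + dt *: (((1 - eta k.+1) * xi k.+1) *: z k.+1
                          - xi k.+1 *: grad f (x k));
  vos_x : forall k : nat,
    x k.+1 = x k + (1 - xi k.+1) *: (y k - x k)
             + dt *: (xi k.+1 *: z k.+1 + y k.+1 - y k);
  vos_v : forall k : nat, v k.+1 = y k.+1 - x k.+1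
}.

(* Main.v *)
Require Import Defs.
From mathcomp Require Import ring.

Set Implicit Arguments.
Unset Strict Implicit.
Unset Printing Implicit Defensive.

Local Open Scope ring_scope.

(** The update is built so that [y (k+1) - x (k+1) = xi (k+1) *: z (k+1)]:
    eliminating [y] and [x] from the two update formulas leaves [xi (k+1)] times
    an affine combination of [v k], the gradient and [z (k+1)], and the
    denominator in the definition of [z (k+1)] is the one that makes this
    combination collapse to [z (k+1)] itself ([vos_gap]).

    The energy identity, written for the unknown [t = xi (k+1)], is then the
    scalar equation [dt * eta * |z|^2 * t^2 + E^k * t = xi k * E^(k-1)].  Its
    linear coefficient and right-hand side are positive, the latter because
    [xi k] is.  When [z != 0] the multiplier is the larger root of this
    quadratic, which is positive ([quadratic_root]); when [z = 0] the equation
    is linear with a positive solution.  So positivity of the multiplier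
    propagates by induction from [xi 0 = 1], and the dissipation identity comes
    with it ([vos_multiplier_step]). *)

Lemma enorm_sqr (R : realType) (N : nat) (u : 'rV[R]_N) :
  enorm u ^+ 2 = dot u u.
Proof.
by rewrite sqr_sqrtr //; apply: sumr_ge0 => i _; rewrite -expr2 sqr_ge0.
Qed.

Lemma enorm_sqrZ (R : realType) (N : nat) (a : R) (u : 'rV[R]_N) :
  enorm (a *: u) ^+ 2 = a ^+ 2 * enorm u ^+ 2.
Proof.
rewrite !enorm_sqr /dot mulr_sumr; apply: eq_bigr => i _.
by rewrite !mxE; ring.
Qed.

(** With [c] and [m] positive the discriminant exceeds [b ^+ 2], so the root
    with the plus sign is positive whatever the sign of [b]. *)
Lemma quadratic_root (R : rcfType) (b c m : R) : 0 < c -> 0 < m ->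
  let t := (- b + Num.sqrt (b ^+ 2 + 4 * c * m)) / (2 * c) in
  0 < t /\ c * t ^+ 2 + b * t = m.
Proof.
move=> c0 m0 t.
have cm0 : 0 < 4 * c * m by rewrite !mulr_gt0.
have d0 : 0 <= b ^+ 2 + 4 * c * m by rewrite addr_ge0 ?sqr_ge0 ?ltW.
have bs : b < Num.sqrt (b ^+ 2 + 4 * c * m).
  apply: le_lt_trans (ler_norm b) _.
  by rewrite -sqrtr_sqr ltr_sqrt ?ltrDl // ltr_wpDl ?sqr_ge0.
split; first by rewrite divr_gt0 ?mulr_gt0 // addrC subr_gt0.
have /eqP := sqr_sqrtr d0; rewrite -subr_eq0 => /eqP sE.
apply/eqP; rewrite -subr_eq0; apply/eqP.
rewrite /t; set s := Num.sqrt _ in sE *.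
have -> : c * ((- b + s) / (2 * c)) ^+ 2 + b * ((- b + s) / (2 * c)) - m
    = (s ^+ 2 - (b ^+ 2 + 4 * c * m)) / (4 * c) by field; rewrite gt_eqF.
by rewrite sE mul0r.
Qed.

Lemma vos_gap (R : realType) (N : nat) (f : 'rV[R]_N -> R) (dt : R)
    (eta : nat -> R) (x y z v : nat -> 'rV[R]_N) (xi : nat -> R) (k : nat) :
  dt != 0 -> vos_denom dt (eta k.+1) != 0 -> LLM_VOS f dt eta x y z v xi ->
  y k.+1 - x k.+1 = xi k.+1 *: z k.+1.
Proof.
move=> dt0 D0 alg.
have vE : v k = y k - x k.
  by case: (k) => [|j]; [exact: (vos_v0 alg) | exact: (vos_v alg)].
have zE := vos_z alg k; rewrite vE in zE.
rewrite (vos_x alg) (vos_y alg).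
apply/rowP => i; move/rowP: zE => /(_ i); rewrite !mxE => zE.
(* Solving the z-update for the gap [y k - x k] avoids dividing by the
   denominator in the final identity. *)
have gapE : y k 0 i - x k 0 i
    = dt * (vos_denom dt (eta k.+1) * z k.+1 0 i
            + (1 - dt) * grad f (x k) 0 i).
  by rewrite zE !mxE; field; rewrite dt0 D0.
have -> : y k 0 i = x k 0 i + dt * (vos_denom dt (eta k.+1) * z k.+1 0 i
            + (1 - dt) * grad f (x k) 0 i) by rewrite -gapE; ring.
by rewrite /vos_denom !mxE; field.
Qed.

Lemma vos_multiplier_step (R : realType) (N : nat) (f : 'rV[R]_N -> R)
    (dt : R) (eta : nat -> R) (x y z v : nat -> 'rV[R]_N) (xi : nat -> R)
    (k : nat) :
  (forall x y : 'rV[R]_N, 0 < pseudo_energy f x y) ->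
  0 < dt -> 0 < eta k.+1 -> LLM_VOS f dt eta x y z v xi -> 0 < xi k ->
  0 < xi k.+1 /\
  dt * eta k.+1 * enorm (xi k.+1 *: z k.+1) ^+ 2
    + modified_energy f x y xi k.+1 = modified_energy f x y xi k.
Proof.
move=> E_pos dt0 eta0 alg xi0.
rewrite enorm_sqrZ /modified_energy {1}/prev_energy /=.
have := vos_xi alg k => /=.
have E0 := E_pos (x k) (y k); set E := pseudo_energy f (x k) (y k) in E0 *.
have P0 : 0 < prev_energy f x y k := E_pos _ _.
set P := prev_energy f x y k in P0 *.
case: eqVneq => [-> | nz] /= xiE; rewrite xiE.
  by split; [rewrite divr_gt0 ?mulr_gt0 | field; rewrite gt_eqF].
have c0 : 0 < eta k.+1 * enorm (z k.+1) ^+ 2.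
  by rewrite mulr_gt0 // exprn_gt0 // lt0r nz sqrtr_ge0.
have m0 : 0 < xi k * P / dt by rewrite divr_gt0 ?mulr_gt0.
have [t0 tE] := quadratic_root (R := R) (E / dt) c0 m0.
split=> //; rewrite -xiE in tE *.
have -> : xi k * P = dt * (xi k * P / dt) by field; rewrite gt_eqF.
by rewrite -tE; field; rewrite gt_eqF.
Qed.

Theorem theorem2p3 (R : realType) (N : nat) (f : 'rV[R]_N -> R)
    (f_diff : forall x : 'rV[R]_N, differentiable f x)
    (f_min : exists xstar : 'rV[R]_N, forall x : 'rV[R]_N, f xstar <= f x)
    (E_pos : forall x y : 'rV[R]_N, 0 < pseudo_energy f x y)
    (dt : R) (dt_pos : 0 < dt)
    (eta : nat -> R) (eta_pos : forall k : nat, (1 <= k)%N -> 0 < eta k)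
    (denom_neq0 : forall k : nat, vos_denom dt (eta k.+1) != 0)
    (x y z v : nat -> 'rV[R]_N) (xi : nat -> R)
    (alg : LLM_VOS f dt eta x y z v xi) :
  (forall k : nat, 0 < xi k) /\
  (forall k : nat,
     modified_energy f x y xi k.+1 - modified_energy f x y xi k
       = - (dt * eta k.+1 * enorm (y k.+1 - x k.+1) ^+ 2) /\
     - (dt * eta k.+1 * enorm (y k.+1 - x k.+1) ^+ 2) <= 0).
Proof.
have xi_pos : forall k, 0 < xi k.
  elim=> [|k IHk]; first by rewrite (vos_xi0 alg).
  by have [] := vos_multiplier_step E_pos dt_pos (eta_pos k.+1 isT) alg IHk.
split=> // k; have eta0 := eta_pos k.+1 isT; split.
  have [_ <-] := vos_multiplier_step E_pos dt_pos eta0 alg (xi_pos k).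
  by rewrite (vos_gap (lt0r_neq0 dt_pos) (denom_neq0 k) alg); ring.
by rewrite oppr_le0 mulr_ge0 ?sqr_ge0 // mulr_ge0 // ltW.
Qed.
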